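(* Let $n\ge3$, let $a=(x_1^T,\dots,x_n^T)^T$ with $x_k=(\cos\theta_k,\sin\theta_k)^T$, $\theta_k=2\pi k/n$, be the regular $n$-gon central configuration with all masses equal to $1$, let $\lambda=\frac14\sum_{j=1}^{n-1}\csc\frac{\pi j}{n}$ and $\mathfrak{e}\in[0,1)$. Let $A$ be the $2n\times 2n$ matrix $A=(A_{cen},A(0),A(1),\dots,A([\frac n2]))$ built in the context. Then the linear Hamiltonian system of the regular $n$-gon elliptic relative equilibrium, $$\zeta_{\mathfrak{e}}'(\theta)=J_{4n}B(\theta)\zeta_{\mathfrak{e}}(\theta),\quad \zeta_{\mathfrak{e}}(0)=I_{4n},\qquad B(\theta)=\begin{pmatrix}I_{2n}&-\mathbb{J}_n\\ \mathbb{J}_n& I_{2n}-\dfrac{I_{2n}+\frac1\lambda A^TD^2U(a)A}{1+\mathfrak{e}\cos\theta}\end{pmatrix},$$ satisfies $$B(\theta)=B_1(\theta)\diamond B_2(\theta)\diamond B_3(\theta),\qquad B_3(\theta)=\mathcal{B}_1(\theta)\diamond\cdots\diamond\mathcal{B}_{[\frac n2]}(\theta),$$ where $$B_1(\theta)=\begin{pmatrix}I_2&-\mathbb{J}_1\\ \mathbb{J}_1&I_2-\frac{I_2}{1+\mathfrak{e}\cos\theta}\end{pmatrix}\ \text{(translation symmetry)},\qquad B_2(\theta)=\begin{pmatrix}I_2&-\mathbb{J}_1\\ \mathbb{J}_1&I_2-\frac{I_2+\mathcal{U}_0}{1+\mathfrak{e}\cos\theta}\end{pmatrix}\ \text{(dilation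 and rotation symmetries)},$$ and, for $l=1,\dots,[\frac n2]$ (the core part of the linearized system), $$\mathcal{B}_l(\theta)=\begin{pmatrix}I&-\mathbb{J}\\ \mathbb{J}&I-\frac{I+\mathcal{U}_l}{1+\mathfrak{e}\cos\theta}\end{pmatrix},$$ with $I,\mathbb{J}$ of the same size as $\mathcal{U}_l$ and with the matrices $\mathcal{U}_0,\mathcal{U}_l$ given explicitly in the context.
   Context: $U(q)=\sum_{i<j}\frac{1}{\|q_i-q_j\|}$ on $(\mathbb{R}^2)^n$ (unit masses), $D^2U$ its Hessian. $I_j$ is the identity, $J_{2j}=\begin{pmatrix}0_j&-I_j\\ I_j&0_j\end{pmatrix}$, $\mathbb{J}_k=\mathrm{diag}(J_2,\dots,J_2)$ ($2k\times2k$). $[x]$ is the integer part. The displayed system for $\zeta_{\mathfrak{e}}$ is the linearized Hamiltonian system along the elliptic relative equilibrium (homographic Kepler solution of eccentricity $\mathfrak{e}$) generated by $a$, written in suitable symplectic coordinates with the true anomaly $\theta\in[0,2\pi]$ as independent variable; it is defined for any invertible $A$ with $\mathbb{J}_nA=A\mathbb{J}_n$, $A^TA=I_{2n}$. Symplectic sum: for $M_1=\begin{pmatrix} A_1 & A_2 \\ A_3 & A_4 \end{pmatrix}$, $M_2=\begin{pmatrix} B_1 & B_2 \\ B_3 & B_4 \end{pmatrix}$ (square blocks), $M_1\diamond M_2=\begin{pmatrix} A_1 & 0 & A_2 & 0 \\ 0 & B_1 & 0 & B_2 \\ A_3 & 0 & A_4 & 0 \\ 0 & B_3 & 0 & B_4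 \end{pmatrix}$. Matrix $A$: write $\theta_{kl}=2\pi kl/n$, $e_1=(1,0,1,0,\dots,1,0)^T$, $v(1)=(\cos2\theta_1,\sin2\theta_1,\dots,\cos2\theta_n,\sin2\theta_n)^T$, and for $l\ge2$ let $v(l),w(l)\in\mathbb{R}^{2n}$ be the column vectors whose $k$-th $\mathbb{R}^2$-components are $\cos\theta_{kl}\,(\cos\theta_k,\sin\theta_k)$ and $\sin\theta_{kl}\,(\cos\theta_k,\sin\theta_k)$, $k=1,\dots,n$. Put $A_{cen}=\frac1{\sqrt n}(e_1,\mathbb{J}_ne_1)$, $A(0)=\frac1{\sqrt n}(a,\mathbb{J}_na)$, $A(1)=\frac1{\sqrt n}(v(1),\mathbb{J}_nv(1))$, $A(l)=\sqrt{\frac2n}\,(v(l),\mathbb{J}_nv(l),w(l),\mathbb{J}_nw(l))$ for $2\le l\le[\frac{n-1}2]$, and, if $n$ is even, $A(\frac n2)=\frac1{\sqrt n}(v(\frac n2),\mathbb{J}_nv(\frac n2))$. Matrices $\mathcal{U}_l$: with $d_{nj}=\|x_n-x_j\|=2\sin\frac{\pi j}{n}$, $$\mathcal{U}_0=\begin{pmatrix} 2 & 0 \\ 0 & -1 \end{pmatrix},\quad \mathcal{U}_1=\frac1\lambda\begin{pmatrix} z & 0 \\ 0 & z \end{pmatrix},\quad z=\sum_{j=1}^{n-1}\frac{1-\cos2\theta_j}{2d_{nj}^3},$$ $$\mathcal{U}_l=\frac1\lambda\begin{pmatrix} a_l & 0 & 0 & S_l \\ 0 & b_l & -S_l & 0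 \\ 0 & -S_l & a_l & 0 \\ S_l & 0 & 0 & b_l \end{pmatrix}\ (2\le l\le[\tfrac{n-1}2]),\qquad \mathcal{U}_{\frac n2}=\frac1\lambda\begin{pmatrix} a_{n/2} & 0 \\ 0 & b_{n/2} \end{pmatrix}\ (n\text{ even}),$$ $a_l=P_l-3Q_l$, $b_l=P_l+3Q_l$, $P_l=\sum_{j=1}^{n-1}\frac{1-\cos\theta_{jl}\cos\theta_j}{2d_{nj}^3}$, $S_l=\sum_{j=1}^{n-1}\frac{\sin\theta_{jl}\sin\theta_j}{2d_{nj}^3}$, $Q_l=\sum_{j=1}^{n-1}\frac{\cos\theta_j-\cos\theta_{jl}}{2d_{nj}^3}$. *)

(* Defs.v *)
From HB Require Import structures.
From mathcomp Require Import all_boot all_order all_algebra.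
From mathcomp Require Import all_classical all_reals all_analysis.
From mathcomp Require Import zify.

Set Implicit Arguments.
Unset Strict Implicit.
Unset Printing Implicit Defensive.

Import Order.TTheory GRing.Theory Num.Theory.
Import numFieldNormedType.Exports.
Local Open Scope classical_set_scope.
Local Open Scope ring_scope.

Section SymplecticAlgebra.
Variable R : realType.

Definition mxrows m d (s : seq (seq R)) : 'M[R]_(m, d) :=
  \matrix_(i, j) (nth [::] s i)`_j.

Definition mxcols m d (s : seq 'cV[R]_m) : 'M[R]_(m, d) :=
  \matrix_(i, j) s`_j i ord0.

Definition sympJ j : 'M[R]_(j + j) := block_mx 0 (- 1%:M) 1%:M 0.

(* diag(J_2, ..., J_2); meaningful for even d only.  It is indexed by the full
   size d rather than by d / 2, so that it can be formed at the size of any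
   given matrix. *)
Definition diagJ d : 'M[R]_d :=
  \matrix_(i, j) if i./2 == j./2
                 then sympJ 1 (inord (odd i)) (inord (odd j)) else 0.

Definition sympsum p q (M : 'M[R]_(p + p)) (N : 'M[R]_(q + q)) :
    'M[R]_((p + q) + (p + q)) :=
  block_mx (block_mx (ulsubmx M) 0 0 (ulsubmx N))
           (block_mx (ursubmx M) 0 0 (ursubmx N))
           (block_mx (dlsubmx M) 0 0 (dlsubmx N))
           (block_mx (drsubmx M) 0 0 (drsubmx N)).

(* d 1 + ... + d k *)
Fixpoint sumdim (d : nat -> nat) (k : nat) : nat :=
  if k is k'.+1 then (sumdim d k' + d k'.+1)%N else 0%N.

(* M 1 <+> ... <+> M k; the 0 x 0 matrix is neutral for the symplectic sum *)
Fixpoint bigsympsum (d : nat -> nat) (M : forall l, 'M[R]_(d l + d l)) k :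
    'M[R]_(sumdim d k + sumdim d k) :=
  match k with
  | 0 => 0
  | k'.+1 => sympsum (bigsympsum M k') (M k'.+1)
  end.

Fixpoint bigrow m (d : nat -> nat) (C : forall l, 'M[R]_(m, d l)) k :
    'M[R]_(m, sumdim d k) :=
  match k with
  | 0 => 0
  | k'.+1 => row_mx (bigrow C k') (C k'.+1)
  end.

(* Every coefficient matrix below has this shape, for its own V. *)
Definition kepler_coef d (V : 'M[R]_d) (ecc theta : R) : 'M[R]_(d + d) :=
  block_mx 1%:M (- diagJ d)
           (diagJ d) (1%:M - (1 + ecc * cos theta)^-1 *: (1%:M + V)).

(* zeta' = J_{2m} B zeta on [0, 2 pi], zeta(0) = I.  Only the values of zeta on
   [0, 2 pi] matter: the equation is required in the interior, together with
   continuity up to the endpoints. *)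
Definition fundamental_solution m (B zeta : R -> 'M[R]_(m + m)) : Prop :=
  [/\ zeta 0 = 1%:M,
      forall i j, {within `[0, 2 * pi],
                     continuous (fun t => zeta t i j)} &
      forall theta, 0 < theta < 2 * pi -> forall i j,
        is_derive theta 1 (fun t => zeta t i j)
          ((sympJ m *m B theta *m zeta theta) i j)].

End SymplecticAlgebra.

Infix "<+>" := sympsum (at level 50, left associativity).

Section Potential.
Variables (R : realType) (n : nat).

(* Euclidean norm; the library norm `|x| on matrices is the sup norm. *)
Definition enorm (x : 'rV[R]_2) : R := Num.sqrt (\sum_c x ord0 c ^+ 2).

Fact coord_subproof (k : 'I_n) (c : 'I_2) : (2 * k + c < 2 * n)%N.
Proof. by have := ltn_ord k; have := ltn_ord c; lia. Qed.

(* k : 'I_n stands for the body number k + 1 *)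
Definition body (q : 'cV[R]_(2 * n)) (k : 'I_n) : 'rV[R]_2 :=
  \row_c q (Ordinal (coord_subproof k c)) ord0.

Definition newtonU (q : 'cV[R]_(2 * n)) : R :=
  \sum_(i < n) \sum_(j < n | (i < j)%N) (enorm (body q i - body q j))^-1.

Definition hessian (f : 'cV[R]_(2 * n) -> R) (q : 'cV[R]_(2 * n)) :
    'M[R]_(2 * n) :=
  \matrix_(i, j) 'D_(delta_mx i ord0)
    (fun p => 'D_(delta_mx j ord0) f p) q.

(* (x 1; ...; x n) as a column vector of R^2n *)
Definition stack (x : nat -> 'rV[R]_2) : 'cV[R]_(2 * n) :=
  \col_i x (i./2).+1 ord0 (inord (odd i)).

End Potential.

Section RegularPolygon.
Variables (R : realType) (n : nat).

(* ang k = theta_k and ang (k * l) = theta_{kl} *)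
Definition ang (k : nat) : R := 2 * pi * k%:R / n%:R.

Definition unitvec (t : R) : 'rV[R]_2 :=
  \row_(c < 2) if c == ord0 then cos t else sin t.

Definition ngon_vertex (k : nat) : 'rV[R]_2 := unitvec (ang k).

Definition ngon : 'cV[R]_(2 * n) := stack n ngon_vertex.

Definition lambda : R :=
  4^-1 * \sum_(1 <= j < n) (sin (pi * j%:R / n%:R))^-1.

Definition e1 : 'cV[R]_(2 * n) := stack n (fun _ => delta_mx ord0 ord0).
Definition v1 : 'cV[R]_(2 * n) := stack n (fun k => unitvec (2 * ang k)).
Definition v (l : nat) : 'cV[R]_(2 * n) :=
  stack n (fun k => cos (ang (k * l)) *: unitvec (ang k)).
Definition w (l : nat) : 'cV[R]_(2 * n) :=
  stack n (fun k => sin (ang (k * l)) *: unitvec (ang k)).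

Definition generic_mode (l : nat) : bool := (2 <= l <= (n.-1)./2)%N.

(* Number of columns of A(l), i.e. size of U_l, for 1 <= l <= n/2 *)
Definition mode_dim (l : nat) : nat := if generic_mode l then 4 else 2.

Let JJ := diagJ R (2 * n).

Definition A_cen : 'M[R]_(2 * n, 2) :=
  (Num.sqrt n%:R)^-1 *: mxcols 2 [:: e1; JJ *m e1].
Definition A_0 : 'M[R]_(2 * n, 2) :=
  (Num.sqrt n%:R)^-1 *: mxcols 2 [:: ngon; JJ *m ngon].
Definition A_1 : 'M[R]_(2 * n, 2) :=
  (Num.sqrt n%:R)^-1 *: mxcols 2 [:: v1; JJ *m v1].
Definition A_gen (l : nat) : 'M[R]_(2 * n, 4) :=
  Num.sqrt (2 / n%:R) *: mxcols 4 [:: v l; JJ *m v l; w l; JJ *m w l].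
Definition A_half (l : nat) : 'M[R]_(2 * n, 2) :=
  (Num.sqrt n%:R)^-1 *: mxcols 2 [:: v l; JJ *m v l].

(* For 1 <= l <= n/2 with l <> 1 and l not generic, n is even and l = n/2. *)
Definition A_ (l : nat) : 'M[R]_(2 * n, mode_dim l) :=
  if generic_mode l as b return 'M[R]_(2 * n, if b then 4 else 2)
  then A_gen l else if l == 1%N then A_1 else A_half l.

Definition dist (j : nat) : R := enorm (ngon_vertex n - ngon_vertex j).

Definition P_ (l : nat) : R :=
  \sum_(1 <= j < n) (1 - cos (ang (j * l)) * cos (ang j)) / (2 * dist j ^+ 3).
Definition S_ (l : nat) : R :=
  \sum_(1 <= j < n) (sin (ang (j * l)) * sin (ang j)) / (2 * dist j ^+ 3).
Definition Q_ (l : nat) : R :=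
  \sum_(1 <= j < n) (cos (ang j) - cos (ang (j * l))) / (2 * dist j ^+ 3).
Definition a_ (l : nat) : R := P_ l - 3 * Q_ l.
Definition b_ (l : nat) : R := P_ l + 3 * Q_ l.
Definition z_ : R :=
  \sum_(1 <= j < n) (1 - cos (2 * ang j)) / (2 * dist j ^+ 3).

Definition U_0 : 'M[R]_2 := mxrows 2 2 [:: [:: 2; 0]; [:: 0; -1]].
Definition U_1 : 'M[R]_2 :=
  lambda^-1 *: mxrows 2 2 [:: [:: z_; 0]; [:: 0; z_]].
Definition U_gen (l : nat) : 'M[R]_4 :=
  lambda^-1 *: mxrows 4 4
    [:: [:: a_ l; 0; 0; S_ l];
        [:: 0; b_ l; - S_ l; 0];
        [:: 0; - S_ l; a_ l; 0];
        [:: S_ l; 0; 0; b_ l]].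
Definition U_half (l : nat) : 'M[R]_2 :=
  lambda^-1 *: mxrows 2 2 [:: [:: a_ l; 0]; [:: 0; b_ l]].

Definition U_ (l : nat) : 'M[R]_(mode_dim l) :=
  if generic_mode l as b return 'M[R]_(if b then 4 else 2)
  then U_gen l else if l == 1%N then U_1 else U_half l.

Lemma sumdim_mode_dim k : (0 < k)%N -> (k <= (n.-1)./2)%N ->
  sumdim mode_dim k = (4 * k - 2)%N.
Proof.
elim: k => // -[|k] IH _ hk.
  by rewrite /= /mode_dim /generic_mode.
have hk' : (k.+1 <= (n.-1)./2)%N by lia.
have E := IH isT hk'.
have -> : sumdim mode_dim k.+2 = (sumdim mode_dim k.+1 + mode_dim k.+2)%N by [].
by rewrite E /mode_dim /generic_mode hk /=; lia.
Qed.

Lemma ngon_dim : (3 <= n)%N ->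
  (2 + 2 + sumdim mode_dim (n./2) = 2 * n)%N.
Proof.
move=> hn; have [on|en] := boolP (odd n).
  have -> : n./2 = (n.-1)./2 by lia.
  by rewrite sumdim_mode_dim; lia.
have -> : n./2 = ((n.-1)./2).+1 by lia.
have -> : sumdim mode_dim ((n.-1)./2).+1
  = (sumdim mode_dim ((n.-1)./2) + mode_dim ((n.-1)./2).+1)%N by [].
rewrite sumdim_mode_dim; [|lia|lia].
by rewrite /mode_dim /generic_mode ltnn andbF; lia.
Qed.

Definition ngon_A (hn : (3 <= n)%N) : 'M[R]_(2 * n) :=
  castmx (erefl, ngon_dim hn) (row_mx (row_mx A_cen A_0) (bigrow A_ (n./2))).

Definition ngon_B (hn : (3 <= n)%N) (ecc theta : R) :
    'M[R]_(2 * n + 2 * n) :=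
  let A := ngon_A hn in
  kepler_coef (lambda^-1 *: (A^T *m hessian (@newtonU R n) ngon *m A))
    ecc theta.

Definition B_1 (ecc theta : R) : 'M[R]_(2 + 2) := kepler_coef 0 ecc theta.
Definition B_2 (ecc theta : R) : 'M[R]_(2 + 2) := kepler_coef U_0 ecc theta.
Definition Bcal (ecc theta : R) (l : nat) : 'M[R]_(mode_dim l + mode_dim l) :=
  kepler_coef (U_ l) ecc theta.
Definition B_3 (ecc theta : R) :
    'M[R]_(sumdim mode_dim (n./2) + sumdim mode_dim (n./2)) :=
  bigsympsum (Bcal ecc theta) (n./2).

Definition ngon_dim2 (hn : (3 <= n)%N) := congr2 addn (ngon_dim hn) (ngon_dim hn).

End RegularPolygon.

(* Main.v *)
(** In the rotating frame [u_k = (cos theta_k, sin theta_k)], [J u_k] the Hessian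
    of [U] at the regular polygon becomes block circulant: a chord
    [u_k - u_(k+m)] has coordinates [(1 - cos theta_m, - sin theta_m)] in that
    frame, whatever [k] is.  Hence for every frequency [l] the span of [v l],
    [J v l], [w l], [J w l] is invariant, and the sums over [m] that are odd
    under [m -> n - m] drop out, leaving the 4 x 4 matrix of the [a_l], [b_l],
    [S_l].  All the columns of [A] come from these spans: frequency 0 gives
    [A(0)], the frequency-1 span splits into [A_cen] (its kernel) and [A(1)],
    and for [l = n/2] half of the span vanishes.  The orthogonality relations
    between the spans are those of the discrete Fourier modes. *)
Require Import Defs.
From mathcomp Require Import all_boot all_order all_algebra.
From mathcomp Require Import all_classical all_reals all_analysis.
From mathcomp Require Import ring lra zify.
Import Order.TTheory GRing.Theory Num.Theory.
Local Open Scope ring_scope.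

Set Implicit Arguments.
Unset Strict Implicit.
Unset Printing Implicit Defensive.

(** * Second derivatives of the Newtonian potential *)

Section Hessian.
Import numFieldNormedType.Exports.
Local Open Scope classical_set_scope.
Variable R : realType.
Implicit Types (r s : 'rV[R]_2).

Definition dot r s : R := r 0 0 * s 0 0 + r 0 1 * s 0 1.

Lemma enormE r : enorm r = Num.sqrt (dot r r).
Proof.
rewrite /enorm big_ord_recl big_ord1 !expr2 (_ : lift _ _ = 1) //.
exact/val_inj.
Qed.

Lemma enorm_sqr r : enorm r ^+ 2 = dot r r.
Proof. by rewrite enormE sqr_sqrtr // addr_ge0 // -expr2 sqr_ge0. Qed.

(** Along a line the squared norm is a quadratic polynomial in the parameter, so polynomial
    differentiation rules apply. *)
Lemma is_derive_dot_line r s (x : R) :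
  is_derive x 1 (fun t => dot (r + t *: s) (r + t *: s)) (2 * dot (r + x *: s) s).
Proof.
have E : (fun t => dot (r + t *: s) (r + t *: s)) =
  horner (((r 0 0)%:P + s 0 0 *: 'X) ^+ 2 + ((r 0 1)%:P + s 0 1 *: 'X) ^+ 2).
  by apply/funext => t; rewrite !hornerE /dot !mxE; ring.
rewrite E; apply: (@is_derive_eq _ _ _ _ _ _ _ _ (is_derive_poly _ _)).
rewrite !expr2 !(derivD, derivM, derivC, derivZ, derivX) !hornerE.
by rewrite /dot !mxE /=; ring.
Qed.

Lemma enorm_gt0 r : 0 < dot r r -> 0 < enorm r.
Proof. by move=> r0; rewrite enormE sqrtr_gt0. Qed.

Lemma is_derive_inv_enorm_line r s : 0 < dot r r ->
  is_derive (0 : R) (1 : R) (fun t => (enorm (r + t *: s))^-1)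
    (- dot r s / enorm r ^+ 3).
Proof.
move=> r0; have e0 := enorm_gt0 r0.
have r0E : r + 0 *: s = r by rewrite scale0r addr0.
have sq : is_derive (dot (r + 0 *: s) (r + 0 *: s)) (1 : R) Num.sqrt
    (2 * enorm r)^-1.
  by rewrite r0E enormE; apply: is_derive1_sqrt.
have := @is_derive1_comp R _ (fun t => dot (r + t *: s) (r + t *: s)) _ _ _ sq
  (is_derive_dot_line r s 0).
set f := Num.sqrt \o _ => df.
have fE : f = (fun t => enorm (r + t *: s)).
  by apply/funext => t; rewrite /f /= enormE.
have f0 : f 0 = enorm r by rewrite fE r0E.
have fn0 : f 0 != 0 by rewrite f0 gt_eqF.
have := is_deriveV fn0 df; rewrite fE r0E => dV.
apply: (is_derive_eq dV); rewrite /GRing.scale /=.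
by field; rewrite gt_eqF.
Qed.

(** The Hessian of [1/|r|] applied to [s], that is, the derivative of the gradient [- r / |r|^3] in
    the direction [s]. *)
Definition pair_hessian r s : 'rV[R]_2 :=
  - (enorm r ^- 3) *: s + (3 * dot r s / enorm r ^+ 5) *: r.

Lemma is_derive_pair_gradient r s s' : 0 < dot r r ->
  is_derive (0 : R) (1 : R)
    (fun t => - dot (r + t *: s') s / enorm (r + t *: s') ^+ 3)
    (dot s' (pair_hessian r s)).
Proof.
move=> r0; have e0 := enorm_gt0 r0.
have r0E : r + 0 *: s' = r by rewrite scale0r addr0.
have dl : is_derive (0 : R) (1 : R)
    (horner (- (dot r s)%:P - dot s' s *: 'X)) (- dot s' s).
  apply: (@is_derive_eq _ _ _ _ _ _ _ _ (is_derive_poly _ _)).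
  by rewrite !(derivB, derivN, derivC, derivZ, derivX) !hornerE /=; ring.
have d3 := is_deriveX 3 (is_derive_inv_enorm_line s' r0).
have dg := is_deriveM dl d3.
have -> : (fun t => - dot (r + t *: s') s / enorm (r + t *: s') ^+ 3) =
    (horner (- (dot r s)%:P - dot s' s *: 'X) *
     (fun t => (enorm (r + t *: s'))^-1) ^+ 3).
  apply/funext => t.
  transitivity ((- (dot r s)%:P - dot s' s *: 'X).[t] *
    (enorm (r + t *: s'))^-1 ^+ 3); last by [].
  rewrite !(hornerD, hornerN, hornerC, hornerZ, hornerX) exprVn; congr (_ / _).
  by rewrite /dot !mxE /=; ring.
apply: (is_derive_eq dg).
have -> : ((fun t => (enorm (r + t *: s'))^-1) ^+ 3) 0 = (enorm r)^-1 ^+ 3.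
  by rewrite -[in RHS]r0E.
rewrite !(hornerD, hornerN, hornerC, hornerZ, hornerX) r0E /GRing.scale /=.
rewrite /pair_hessian /dot !mxE /=.
by field; rewrite gt_eqF.
Qed.

(** Reduces directional derivatives on the configuration space to one real variable, where the
    product and chain rules above apply. *)
Lemma derive_line (V : normedModType R) (f : V -> R) (v q : V) :
  'D_v f q = 'D_1 (fun t : R => f (q + t *: v)) 0.
Proof.
rewrite /derive.
suff -> : (fun h : R => h^-1 *: ((f \o shift q) (h *: v) - f q)) =
  (fun h : R => h^-1 *: (((fun t : R => f (q + t *: v)) \o shift 0) (h *: 1) -
     f (q + 0 *: v))) by [].
apply/funext => h /=.
by rewrite scale0r !addr0 /GRing.scale /= mulr1 [q + _]addrC.
Qed.

Lemma is_derive_bigsum (I : Type) (rs : seq I) (P : pred I) (x : R)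
    (h : I -> R -> R) (dh : I -> R) :
  (forall i, P i -> is_derive x 1 (h i) (dh i)) ->
  is_derive x 1 (fun t => \sum_(i <- rs | P i) h i t) (\sum_(i <- rs | P i) dh i).
Proof.
move=> dP; rewrite (_ : (fun _ => _) = \sum_(i <- rs | P i) h i); last first.
  by apply/funext => t; rewrite fct_sumE.
by elim/big_ind2: _ => // [|] *; [exact: is_derive_cst|exact: is_deriveD].
Qed.

Variable n : nat.
Implicit Types q v w : 'cV[R]_(2 * n).
Implicit Types i k : 'I_n.

Definition body_diff q i k : 'rV[R]_2 := body q i - body q k.

Definition collision_free q :=
  forall i k, (i < k)%N -> 0 < dot (body_diff q i k) (body_diff q i k).

Lemma body_diff_line q v (t : R) i k :
  body_diff (q + t *: v) i k = body_diff q i k + t *: body_diff v i k.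
Proof. by apply/rowP => c; rewrite !mxE; ring. Qed.

Lemma derive_newtonU q v : collision_free q ->
  'D_v (@newtonU R n) q = \sum_(i < n) \sum_(k < n | (i < k)%N)
    - dot (body_diff q i k) (body_diff v i k) / enorm (body_diff q i k) ^+ 3.
Proof.
move=> q0; rewrite derive_line /newtonU.
rewrite (_ : (fun _ => _) = fun t => \sum_(i < n) \sum_(k < n | (i < k)%N)
    (enorm (body_diff q i k + t *: body_diff v i k))^-1); last first.
  apply/funext => t; apply: eq_bigr => i _; apply: eq_bigr => k _.
  by rewrite -body_diff_line.
apply: derive_val; apply: is_derive_bigsum => i _.
by apply: is_derive_bigsum => k /q0; exact: is_derive_inv_enorm_line.
Qed.

(** The first derivative formula is available only away from collisions; differentiating it again
    requires it on a whole neighbourhood. Continuity of the finitely many squared distances provides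
    one. *)
Lemma collision_free_near q v : collision_free q ->
  \forall t \near (0 : R), collision_free (q + t *: v).
Proof.
move=> q0; have cf i k : \forall t \near (0 : R), (i < k)%N ->
    0 < dot (body_diff (q + t *: v) i k) (body_diff (q + t *: v) i k).
  have [ik|ki] := boolP (i < k)%N; last by near=> t.
  have d := is_derive_dot_line (body_diff q i k) (body_diff v i k) 0.
  have /derivable1_diffP /differentiable_continuous c :=
    @ex_derive _ _ _ _ _ _ _ d.
  have gt0 : 0 < dot (body_diff q i k + 0 *: body_diff v i k)
                     (body_diff q i k + 0 *: body_diff v i k).
    by rewrite scale0r addr0; exact: q0.
  near=> t => _; rewrite body_diff_line.
  by near: t; exact: (cvgr_gt _ c _ gt0).
have cfi i := filter_forall (nbhs_filter (0 : R)) (cf i).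
exact: (filter_forall (nbhs_filter (0 : R)) cfi).
Unshelve. all: by end_near. Qed.

Lemma derive2_newtonU q v w : collision_free q ->
  'D_w (fun p => 'D_v (@newtonU R n) p) q =
  \sum_(i < n) \sum_(k < n | (i < k)%N)
    dot (body_diff w i k) (pair_hessian (body_diff q i k) (body_diff v i k)).
Proof.
move=> q0; rewrite derive_line.
rewrite (near_eq_derive (g := fun t : R =>
  \sum_(i < n) \sum_(k < n | (i < k)%N)
    - dot (body_diff q i k + t *: body_diff w i k) (body_diff v i k) /
    enorm (body_diff q i k + t *: body_diff w i k) ^+ 3)); last first.
  near=> t; rewrite derive_newtonU.
    apply: eq_bigr => i _; apply: eq_bigr => k _.
    by rewrite -body_diff_line.
  by near: t; exact: collision_free_near.
apply: derive_val; apply: is_derive_bigsum => i _.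
by apply: is_derive_bigsum => k /q0; exact: is_derive_pair_gradient.
Unshelve. all: by end_near. Qed.

(** By antisymmetry the part [- x k] of the pair [(i, k)] pairs with [h i k] as [x k] does with
    [h k i]. The sum over unordered pairs thus becomes one over ordered pairs, grouped by body. *)
Lemma pair_gradient_sum (x : 'I_n -> 'rV[R]_2) (h : 'I_n -> 'I_n -> 'rV[R]_2) :
  (forall i k, h k i = - h i k) ->
  \sum_(i < n) \sum_(k < n | (i < k)%N) dot (x i - x k) (h i k) =
  \sum_(i < n) dot (x i) (\sum_(k < n) h i k).
Proof.
move=> hN.
have dotS (u : 'rV[R]_2) (I : finType) (P : pred I) (f : I -> 'rV[R]_2) :
    dot u (\sum_(k | P k) f k) = \sum_(k | P k) dot u (f k).
  by rewrite /dot !summxE !mulr_sumr -big_split.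
have h0 i : h i i = 0.
  apply/eqP; have /eqP := hN i i; rewrite -addr_eq0 -mulr2n => /eqP e.
  by apply/eqP/rowP => c; have /rowP /(_ c) := e; rewrite !mxE; lra.
transitivity (\sum_(i < n) (\sum_(k < n | (i < k)%N) dot (x i) (h i k) +
                            \sum_(k < n | (k < i)%N) dot (x i) (h i k))).
  rewrite big_split /=.
  rewrite [X in _ + X](exchange_big_dep xpredT) //= -big_split /=.
  apply: eq_bigr => i _; rewrite -big_split /=; apply: eq_bigr => k _.
  by rewrite (hN i k) /dot !mxE; ring.
apply: eq_bigr => i _; rewrite dotS [RHS](bigID (fun k => (i < k)%N)) /=.
congr (_ + _); rewrite [RHS](bigD1 i) ?ltnn //= h0.
rewrite [X in _ = X + _](_ : _ = 0) ?add0r; last by rewrite /dot !mxE !mulr0 addr0.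
by apply: eq_bigl => k; rewrite -leqNgt ltn_neqAle andbC.
Qed.

(** Summing the columns against [v] recombines the basis vectors into [body_diff v] by linearity;
    [pair_gradient_sum] then groups the pair terms by body. *)
Lemma hessian_newtonU_mul q v : collision_free q ->
  hessian (@newtonU R n) q *m v = \col_j \sum_(i < n)
    dot (body (delta_mx j ord0) i)
        (\sum_(k < n) pair_hessian (body_diff q i k) (body_diff v i k)).
Proof.
move=> q0; apply/colP => j; rewrite !mxE.
rewrite -pair_gradient_sum; last first.
  move=> i k; rewrite /pair_hessian /body_diff.
  rewrite -(opprB (body q i)) -(opprB (body v i)).
  have -> : enorm (- (body q i - body q k)) = enorm (body q i - body q k).
    by rewrite !enormE /dot !mxE !mulrNN.
  by apply/rowP => c; rewrite /dot !mxE; ring.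
under eq_bigr => l _ do rewrite mxE derive2_newtonU // mulr_suml.
rewrite exchange_big; apply: eq_bigr => i _ /=.
under eq_bigr => l _ do rewrite mulr_suml.
rewrite exchange_big; apply: eq_bigr => k _ /=.
have vE c : body_diff v i k ord0 c =
    \sum_l body_diff (delta_mx l ord0) i k ord0 c * v l ord0.
  rewrite !mxE; under eq_bigr => l _ do rewrite !mxE eqxx !andbT mulrBl.
  rewrite sumrB (bigD1 (Ordinal (coord_subproof i c))) //= eqxx mul1r big1; last first.
    by move=> l; rewrite eq_sym => /negPf ->; rewrite mul0r.
  rewrite addr0 (bigD1 (Ordinal (coord_subproof k c))) //= eqxx mul1r big1 ?addr0 //.
  by move=> l; rewrite eq_sym => /negPf ->; rewrite mul0r.
(* Self-adjointness of the pair Hessian frees the column direction, so that the sum over columns can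
   be carried out inside [dot]. *)
have lin (r s : 'rV[R]_2) : dot r (pair_hessian (body_diff q i k) s) =
   dot (pair_hessian (body_diff q i k) r) s.
  by rewrite /pair_hessian /dot !mxE; ring.
rewrite -/(body_diff _ i k) lin [in RHS]/dot !vE !mulr_sumr -big_split.
by apply: eq_bigr => l _; rewrite lin /dot /=; ring.
Qed.

End Hessian.

(** * Stacked planar vectors *)

Section Stack.
Variables (R : realType) (n : nat).
Implicit Types (x y : nat -> 'rV[R]_2).

Lemma coordP (j : 'I_(2 * n)) :
  exists (k : 'I_n) (c : 'I_2), j = Ordinal (coord_subproof k c).
Proof.
have hk : (j./2 < n)%N by have := ltn_ord j; lia.
have hc : (odd j < 2)%N by case: odd.
exists (Ordinal hk), (Ordinal hc); apply/val_inj => /=; lia.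
Qed.

Lemma coord_half (k : 'I_n) (c : 'I_2) : (2 * k + c)./2 = k.
Proof. by have := ltn_ord c; lia. Qed.

Lemma coord_odd (k : 'I_n) (c : 'I_2) : inord (odd (2 * k + c)) = c.
Proof.
apply/val_inj; rewrite /= inordK; last by case: odd.
by have := ltn_ord c; lia.
Qed.

Lemma sum_coord (F : 'I_(2 * n) -> R) :
  \sum_j F j = \sum_(k < n) \sum_(c < 2) F (Ordinal (coord_subproof k c)).
Proof.
rewrite pair_big /=.
pose g (p : 'I_n * 'I_2) := Ordinal (coord_subproof p.1 p.2).
have hk (j : 'I_(2 * n)) : (j./2 < n)%N by have := ltn_ord j; lia.
have hc (j : 'I_(2 * n)) : (odd j < 2)%N by case: odd.
rewrite (reindex g) //; apply: onW_bij.
exists (fun j => (Ordinal (hk j), Ordinal (hc j))) => [[k c]|j].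
  by congr (_, _); apply/val_inj => /=; have := ltn_ord c; lia.
by apply/val_inj => /=; lia.
Qed.

Lemma stackE x (k : 'I_n) (c : 'I_2) i :
  stack n x (Ordinal (coord_subproof k c)) i = x k.+1 ord0 c.
Proof. by rewrite mxE /= coord_half coord_odd. Qed.

Lemma body_stack x (k : 'I_n) : body (stack n x) k = x k.+1.
Proof. by apply/rowP => c; rewrite mxE stackE. Qed.

Lemma eq_stack x y : (forall k, (0 < k)%N -> x k = y k) -> stack n x = stack n y.
Proof. by move=> xy; apply/colP => j; rewrite !mxE xy. Qed.

Lemma stackD x y : stack n x + stack n y = stack n (fun k => x k + y k).
Proof. by apply/colP => j; rewrite !mxE. Qed.

Lemma stackZ a x : a *: stack n x = stack n (fun k => a *: x k).
Proof. by apply/colP => j; rewrite !mxE. Qed.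

Lemma dot_stack x y i j :
  ((stack n x)^T *m stack n y) i j = \sum_(k < n) dot (x k.+1) (y k.+1).
Proof.
rewrite mxE sum_coord; apply: eq_bigr => k _.
rewrite big_ord_recl big_ord1 ![_^T _ _]mxE !stackE /dot.
by congr (_ + _ * _); congr (x k.+1 _ _) + congr (y k.+1 _ _); apply/val_inj.
Qed.

Lemma sum_dot_body_delta (k : 'I_n) (c : 'I_2) (y : 'I_n -> 'rV[R]_2) :
  \sum_(i < n) dot (body (delta_mx (Ordinal (coord_subproof k c)) ord0) i) (y i) =
  y k ord0 c.
Proof.
have coord_eq (i : 'I_n) (d : 'I_2) :
    (Ordinal (coord_subproof i d) == Ordinal (coord_subproof k c)) =
    (i == k) && (d == c).
  rewrite -!val_eqE /=; have := ltn_ord c; have := ltn_ord d; lia.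
rewrite (bigD1 k) //= big1 ?addr0; last first.
  move=> i /negPf ik; rewrite /dot !mxE !coord_eq ik /=.
  by rewrite !mul0r addr0.
rewrite /dot !mxE !coord_eq !eqxx /=.
case: c {coord_eq} => -[|[|//]] h /=; rewrite ?mul0r ?mul1r ?addr0 ?add0r;
  by congr (y k _ _); apply/val_inj.
Qed.

Definition rot90 (r : 'rV[R]_2) : 'rV[R]_2 :=
  \row_c if c == ord0 then - r ord0 1 else r ord0 0.

Lemma sympJ1E (c d : 'I_2) :
  sympJ R 1 c d = if c == d then 0 else if c == ord0 then -1 else 1.
Proof.
have E (i : 'I_2) : i = lshift 1 (ord0 : 'I_1) \/ i = rshift 1 (ord0 : 'I_1).
  by case: i => -[|[|//]] h; [left|right]; apply/val_inj.
rewrite /sympJ; case: (E c) (E d) => -> [] ->.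
- by rewrite block_mxEul mxE eqxx.
- by rewrite block_mxEur !mxE.
- by rewrite block_mxEdl !mxE.
- by rewrite block_mxEdr mxE eqxx.
Qed.

Lemma diagJE d (i j : 'I_d) :
  diagJ R d i j = if i./2 == j./2
    then if odd i == odd j then 0 else if odd i then 1 else -1 else 0.
Proof.
rewrite mxE; case: eqP => // _.
rewrite sympJ1E -!val_eqE /= !inordK; try by case: odd.
by case: (odd i) (odd j) => -[].
Qed.

Lemma diagJ_coord (k i : 'I_n) (c d : 'I_2) :
  diagJ R (2 * n) (Ordinal (coord_subproof k c)) (Ordinal (coord_subproof i d)) =
  if k == i then sympJ R 1 c d else 0.
Proof. by rewrite mxE /= !coord_half !coord_odd (inj_eq val_inj). Qed.

Lemma diagJ_stack x : diagJ R (2 * n) *m stack n x = stack n (fun k => rot90 (x k)).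
Proof.
apply/colP => j; have [k [c ->]] := coordP j.
rewrite stackE mxE sum_coord (bigD1 k) //= [X in _ + X]big1 ?addr0; last first.
  move=> i /negPf ik; apply: big1 => d _.
  by rewrite diagJ_coord eq_sym ik mul0r.
rewrite big_ord_recl big_ord1 !stackE !diagJ_coord eqxx !sympJ1E mxE.
case: c => -[|[|//]] h /=; rewrite ?mul0r ?mul1r ?addr0 ?add0r ?mulN1r.
  by congr (- x k.+1 _ _); apply/val_inj.
by congr (x k.+1 _ _); apply/val_inj.
Qed.

(** Moving the start by one trades the first term for the one a period later, which is equal. The
    left side starts at 1 because the bodies are numbered from 1. *)
Lemma sum_cyclic (V : zmodType) (f : nat -> V) a :
  (forall k, f (k + n)%N = f k) ->
  \sum_(k < n) f k.+1 = \sum_(k < n) f (a + k)%N.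
Proof.
move=> fn.
have step b : \sum_(k < n) f (b.+1 + k)%N = \sum_(k < n) f (b + k)%N.
  case: n fn => [|m] fn; first by rewrite !big_ord0.
  rewrite big_ord_recr big_ord_recl /= addn0 addrC addSnnS fn; congr (_ + _).
  by apply: eq_bigr => i _; rewrite addSnnS.
transitivity (\sum_(k < n) f (0 + k)%N); first by rewrite -step.
by elim: a => [|a IH] //; rewrite step.
Qed.

(** Periodicity allows the sum over the other bodies to be recentred at body [k] and indexed by the
    offset [m]. *)
Lemma hessian_newtonU_stack x y : (0 < n)%N ->
  (forall k, x (k + n)%N = x k) -> (forall k, y (k + n)%N = y k) ->
  collision_free (stack n x) ->
  hessian (@newtonU R n) (stack n x) *m stack n y =
  stack n (fun k => \sum_(1 <= m < n)
    pair_hessian (x k - x (k + m)%N) (y k - y (k + m)%N)).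
Proof.
move=> n0 xn yn x0; rewrite hessian_newtonU_mul //.
apply/colP => j; have [k [c ->]] := coordP j.
rewrite mxE sum_dot_body_delta stackE; congr (fun_of_matrix _ _ _).
under eq_bigr => i _ do rewrite /body_diff !body_stack.
rewrite (@sum_cyclic _ (fun m => pair_hessian (x k.+1 - x m) (y k.+1 - y m)) k.+1);
  last by move=> m; rewrite xn yn.
transitivity (\sum_(0 <= m < n) pair_hessian (x k.+1 - x (k.+1 + m)%N)
                                            (y k.+1 - y (k.+1 + m)%N)).
  by rewrite big_mkord.
rewrite big_ltn // addn0 !subrr.
(* The self-interaction at offset 0 vanishes because only zero vectors are scaled, whatever the
   default value of the inverse powers. *)
have -> : pair_hessian 0 0 = 0 :> 'rV[R]_2 by rewrite /pair_hessian !scaler0 addr0.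
by rewrite add0r.
Qed.
End Stack.

(** * The rotating frame *)

Section Frame.
Variable R : realType.
Implicit Types (p q t c s : R).

(** The vector with radial component [p] and tangential component [q] at angle [t]. *)
Definition frame t p q : 'rV[R]_2 := p *: unitvec t + q *: rot90 (unitvec t).

Lemma rot90_frame t p q : rot90 (frame t p q) = frame t (- q) p.
Proof. by apply/rowP => -[[|[|//]] h]; rewrite !mxE /=; ring. Qed.

Lemma frameD t p q p' q' : frame t p q + frame t p' q' = frame t (p + p') (q + q').
Proof. by rewrite /frame !scalerDl addrACA. Qed.

Lemma frameZ a t p q : a *: frame t p q = frame t (a * p) (a * q).
Proof. by rewrite /frame scalerDr !scalerA. Qed.

Lemma frameB t p q p' q' : frame t p q - frame t p' q' = frame t (p - p') (q - q').
Proof. by rewrite -scaleN1r frameZ frameD !mulN1r. Qed.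

Lemma frame_sum t (I : Type) (r : seq I) (P : pred I) (f g : I -> R) :
  \sum_(i <- r | P i) frame t (f i) (g i) =
  frame t (\sum_(i <- r | P i) f i) (\sum_(i <- r | P i) g i).
Proof. by rewrite /frame !scaler_suml -big_split. Qed.

Lemma frame10 t : unitvec t = frame t 1 0.
Proof. by rewrite /frame scale1r scale0r addr0. Qed.

Lemma dot_frame t p q p' q' : dot (frame t p q) (frame t p' q') = p * p' + q * q'.
Proof.
rewrite /dot !mxE /=.
transitivity ((p * p' + q * q') * (cos t ^+ 2 + sin t ^+ 2)); first ring.
by rewrite cos2Dsin2 mulr1.
Qed.

Lemma frame_rotate t a p q :
  frame (t + a) p q = frame t (p * cos a - q * sin a) (p * sin a + q * cos a).
Proof. by apply/rowP => -[[|[|//]] h]; rewrite !mxE /= cosD sinD; ring. Qed.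

(* The chord [r = (1 - c) u - s u'] satisfies [|r|^2 = 2 (1 - c)], so the
   singular factor [1 / (1 - c)] cancels in the rank-one part of the Hessian. *)
Lemma pair_hessian_frame t c s p q : c ^+ 2 + s ^+ 2 = 1 -> c != 1 ->
  let d := enorm (frame t (1 - c) (- s)) in
  pair_hessian (frame t (1 - c) (- s)) (frame t p q) =
  (2 * d ^+ 3)^-1 *: frame t ((1 - 3 * c) * p - 3 * s * q)
                             ((1 + 3 * c) * q - 3 * s * p).
Proof.
move=> cs c1 d; rewrite /pair_hessian -/d dot_frame !frameZ frameD.
have d2 : d ^+ 2 = 2 * (1 - c).
  by rewrite /d enorm_sqr dot_frame; nra.
have c1' : 1 - c != 0 by rewrite subr_eq0 eq_sym.
have d0 : d != 0.
  by apply: contraNneq c1' => d0; move: d2; rewrite d0; lra.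
have -> : d ^+ 5 = d ^+ 3 * (2 * (1 - c)) by rewrite -d2; ring.
have ssE : s ^+ 2 = (1 - c) * (1 + c) by nra.
congr frame; first by field; rewrite d0.
transitivity (d ^- 3 * (- q - 3 / 2 * s * p + 3 / 2 * (s ^+ 2 / (1 - c)) * q)).
  by field; rewrite ?d0 ?c1'.
by rewrite ssE; field; rewrite ?d0 ?c1'.
Qed.

End Frame.

(** * Angles and distances in the regular polygon *)

Section Polygon.
Variables (R : realType) (n : nat).
Hypothesis n_gt0 : (0 < n)%N.
Local Notation ang := (ang R n).

Let n_neq0 : n%:R != 0 :> R.
Proof. by rewrite pnatr_eq0 -lt0n. Qed.

Lemma angD k m : ang (k + m) = ang k + ang m.
Proof. by rewrite /Defs.ang natrD; field. Qed.

Lemma cos_ang_full l : cos (ang (n * l)) = 1.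
Proof.
have angnS m : ang (n * m.+1) = ang (n * m) + 2 * pi.
  by rewrite mulnS addnC angD /Defs.ang; congr (_ + _); field.
have [] : cos (ang (n * l)) = 1 /\ sin (ang (n * l)) = 0; last by [].
elim: l => [|l [IHc IHs]].
  by rewrite muln0 /Defs.ang mulr0 mul0r cos0 sin0.
rewrite angnS cosD sinD IHc IHs [2 * pi]mulr_natl sin2pi cos2pi.
by split; ring.
Qed.

Lemma sin_ang_full l : sin (ang (n * l)) = 0.
Proof.
have := cos2Dsin2 (ang (n * l)).
rewrite cos_ang_full => /eqP.
by rewrite expr1n addrC -subr_eq0 addrK sqrf_eq0 => /eqP.
Qed.

Lemma cos_angDn k l : cos (ang (k + n * l)) = cos (ang k).
Proof. by rewrite angD cosD cos_ang_full sin_ang_full; ring. Qed.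

Lemma sin_angDn k l : sin (ang (k + n * l)) = sin (ang k).
Proof. by rewrite angD sinD cos_ang_full sin_ang_full; ring. Qed.

Lemma sin_half_ang_gt0 m : (0 < m < n)%N -> 0 < sin (pi * m%:R / n%:R : R).
Proof.
move=> /andP[m0 mn]; apply: sin_gt0_pi.
rewrite divr_gt0 ?mulr_gt0 ?pi_gt0 ?ltr0n //=.
by rewrite ltr_pdivrMr ?ltr0n // ltr_pM2l ?pi_gt0 // ltr_nat.
Qed.

Lemma cos_ang_half m :
  1 - cos (ang m) = 2 * sin (pi * m%:R / n%:R) ^+ 2.
Proof.
have -> : ang m = (pi * m%:R / n%:R) *+ 2 by rewrite /Defs.ang; field.
have := cos2Dsin2 (pi * m%:R / n%:R : R); rewrite cos_mulr2n -mulr_natl; nra.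
Qed.

Lemma cos_ang_neq1 m : (0 < m < n)%N -> cos (ang m) != 1.
Proof.
move=> /sin_half_ang_gt0 s0; rewrite -subr_eq0 -opprB oppr_eq0 cos_ang_half.
by rewrite mulf_eq0 sqrf_eq0 pnatr_eq0 (gt_eqF s0).
Qed.

Lemma dist_sqr m : dist R n m ^+ 2 = 2 * (1 - cos (ang m)).
Proof.
(* [dist] is measured from vertex [n], whose angle is a full turn, so its coordinates are 1 and
   0. *)
have := cos2Dsin2 (ang m); have := sin_ang_full 1; have := cos_ang_full 1.
rewrite muln1 /dist enorm_sqr /dot !mxE /= => -> ->; nra.
Qed.

Lemma dist_gt0 m : (0 < m < n)%N -> 0 < dist R n m.
Proof.
move=> /cos_ang_neq1 c1.
rewrite lt_neqAle sqrtr_ge0 andbT eq_sym; apply: contraNneq c1 => d0.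
by have := dist_sqr m; rewrite d0 => h; apply/eqP; lra.
Qed.

Lemma distE m : (0 < m < n)%N -> dist R n m = 2 * sin (pi * m%:R / n%:R).
Proof.
move=> /sin_half_ang_gt0 s0.
apply/eqP; rewrite -(@eqrXn2 _ 2) ?sqrtr_ge0 ?mulr_ge0 ?(ltW s0) //; apply/eqP.
by rewrite dist_sqr cos_ang_half; ring.
Qed.

Lemma ang_rev m l : (m <= n)%N ->
  ang ((n - m) * l) = ang (n * l) - ang (m * l).
Proof.
move=> mn; have -> : (n * l)%N = ((n - m) * l + m * l)%N by nia.
by rewrite angD addrK.
Qed.

Lemma cos_ang_rev m l : (m <= n)%N ->
  cos (ang ((n - m) * l)) = cos (ang (m * l)).
Proof.
by move=> mn; rewrite ang_rev // cosB cos_ang_full sin_ang_full; ring.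
Qed.

Lemma sin_ang_rev m l : (m <= n)%N ->
  sin (ang ((n - m) * l)) = - sin (ang (m * l)).
Proof.
by move=> mn; rewrite ang_rev // sinB cos_ang_full sin_ang_full; ring.
Qed.

End Polygon.

(** * Invariant spans of the Hessian *)

Section Modes.
Variables (R : realType) (n : nat).
Hypothesis n_gt0 : (0 < n)%N.
Local Notation ang := (ang R n).
Local Notation dist := (dist R n).

Lemma sum_odd (f : nat -> R) :
  (forall m, (0 < m < n)%N -> f (n - m)%N = - f m) -> \sum_(1 <= m < n) f m = 0.
Proof.
move=> fN; have e : \sum_(1 <= m < n) f m = - \sum_(1 <= m < n) f m.
  rewrite {1}big_nat_rev -sumrN; apply: eq_big_nat => m /fN <-.
  by rewrite add1n subSS.
by move: e; lra.
Qed.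

Lemma dist_rev m : (0 < m < n)%N -> dist (n - m) = dist m.
Proof.
move=> mn; apply/eqP; rewrite -(@eqrXn2 _ 2) ?sqrtr_ge0 // !dist_sqr //.
by have := @cos_ang_rev R n n_gt0 m 1; rewrite !muln1 => -> //; lia.
Qed.

Lemma angDM k m l : ang ((k + m) * l) = ang (k * l) + ang (m * l).
Proof. by rewrite mulnDl angD. Qed.

(** Once the sum starts at 0, its first term is [sin 0] and the others are odd under
    [k -> n - k]. *)
Lemma sum_sin_ang m : \sum_(k < n) sin (ang (k.+1 * m)) = 0.
Proof.
rewrite (@sum_cyclic n _ (fun k => sin (ang (k * m))) 0); last first.
  by move=> k; rewrite mulnDl sin_angDn.
rewrite -(big_mkord xpredT (fun k => sin (ang (k * m)))) big_ltn //.
rewrite sum_odd => [|k kn]; last by rewrite sin_ang_rev //; lia.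
by rewrite mul0n /Defs.ang mulr0 mul0r sin0 addr0.
Qed.

Definition cos_sum m : R := \sum_(k < n) cos (ang (k.+1 * m)).

(** Shifting the index by one leaves the sum unchanged, while the addition formula multiplies it by
    [cos (ang m)], up to a sine sum that vanishes. Since [cos (ang m)] differs from 1, the sum is
    zero. *)
Lemma cos_sum_eq0 m : (0 < m < n)%N -> cos_sum m = 0.
Proof.
move=> /(@cos_ang_neq1 R n n_gt0) c1.
have : cos_sum m = cos_sum m * cos (ang m).
  rewrite -[RHS]subr0 -(mul0r (sin (ang m))) -(sum_sin_ang m).
  rewrite !mulr_suml -sumrB /cos_sum.
  rewrite (@sum_cyclic n _ (fun k => cos (ang (k * m))) 2); last first.
    by move=> k; rewrite mulnDl cos_angDn.
  by apply: eq_bigr => k _; rewrite addSnnS angDM mul1n addrC cosD; ring.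
move/eqP; rewrite -subr_eq0 -{1}[cos_sum m]mulr1 -mulrBr mulf_eq0 subr_eq0.
by rewrite [1 == _]eq_sym (negPf c1) orbF => /eqP.
Qed.

Lemma cos_sum_full l : cos_sum (n * l) = n%:R.
Proof.
rewrite /cos_sum (eq_bigr (fun=> 1)) => [|k _].
  by rewrite sumr_const card_ord.
by rewrite mulnCA cos_ang_full.
Qed.

(* Coordinates are taken in the order [v l], [J v l], [w l], [J w l]. *)
Definition mode_coef l (x : 'cV[R]_4) k : 'rV[R]_2 :=
  frame (ang k) (x 0 0 * cos (ang (k * l)) + x 2 0 * sin (ang (k * l)))
                (x 1 0 * cos (ang (k * l)) + x 3 0 * sin (ang (k * l))).

(** Four unnormalized columns for every [l], so that one computation covers all frequencies; the
    last two are zero when [l = 0] or [2 * l = n]. *)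
Definition mode_mx l : 'M[R]_(2 * n, 4) :=
  let J := diagJ R (2 * n) in
  mxcols 4 [:: v R n l; J *m v R n l; w R n l; J *m w R n l].

Lemma sum4 (V : nmodType) (F : 'I_4 -> V) : \sum_i F i = F 0 + F 1 + F 2 + F 3.
Proof.
rewrite !big_ord_recl big_ord0 addr0 !addrA.
by do !congr (_ + _); congr F; apply/val_inj.
Qed.

Lemma mode_mx_mul l x : mode_mx l *m x = stack n (mode_coef l x).
Proof.
have vE : v R n l = stack n (fun k => frame (ang k) (cos (ang (k * l))) 0).
  by apply: eq_stack => k _; rewrite /frame scale0r addr0.
have wE : w R n l = stack n (fun k => frame (ang k) (sin (ang (k * l))) 0).
  by apply: eq_stack => k _; rewrite /frame scale0r addr0.
transitivity (x 0 0 *: v R n l + x 1 0 *: (diagJ R (2 * n) *m v R n l) +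
  x 2 0 *: w R n l + x 3 0 *: (diagJ R (2 * n) *m w R n l)).
  by apply/colP => j; rewrite mxE sum4 !mxE /= -!(mulrC (x _ _)).
rewrite vE wE !diagJ_stack !stackZ !stackD; apply: eq_stack => k _.
rewrite !rot90_frame !frameZ !frameD /mode_coef.
by congr frame; ring.
Qed.

Lemma eq_mulmx_col p q (X Y : 'M[R]_(p, q)) :
  (forall x : 'cV[R]_q, X *m x = Y *m x) -> X = Y.
Proof.
move=> XY; apply/matrixP => i j.
by have /colP /(_ i) := XY (delta_mx j 0); rewrite -!colE !mxE.
Qed.

Lemma dist_frame t m : (0 < m < n)%N ->
  enorm (frame t (1 - cos (ang m)) (- sin (ang m))) = dist m.
Proof.
move=> mn; apply/eqP; rewrite -(@eqrXn2 _ 2) ?sqrtr_ge0 // dist_sqr //.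
rewrite enorm_sqr dot_frame; apply/eqP; have := cos2Dsin2 (ang m); nra.
Qed.

Lemma ngon_collision_free : collision_free (ngon R n).
Proof.
move=> i k ik; rewrite /body_diff !body_stack /ngon_vertex.
have -> : (k.+1 = i.+1 + (k - i))%N by lia.
have mn : (0 < k - i < n)%N by have := ltn_ord k; lia.
rewrite [ang (i.+1 + _)%N]angD // !frame10 frame_rotate frameB.
rewrite !mul1r !mul0r subr0 addr0 sub0r -enorm_sqr dist_frame //.
by rewrite exprn_gt0 // dist_gt0.
Qed.

Definition mode_hessian l : 'M[R]_4 :=
  mxrows 4 4 [:: [:: a_ R n l; 0; 0; S_ R n l];
                 [:: 0; b_ R n l; - S_ R n l; 0];
                 [:: 0; - S_ R n l; a_ R n l; 0];
                 [:: S_ R n l; 0; 0; b_ R n l]].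

Lemma mode_hessianE l (x : 'cV[R]_4) :
  let y := mode_hessian l *m x in
  [/\ y 0 0 = a_ R n l * x 0 0 + S_ R n l * x 3 0,
      y 1 0 = b_ R n l * x 1 0 - S_ R n l * x 2 0,
      y 2 0 = a_ R n l * x 2 0 - S_ R n l * x 1 0 &
      y 3 0 = b_ R n l * x 3 0 + S_ R n l * x 0 0].
Proof. by split; rewrite mxE sum4 !mxE /=; ring. Qed.

Lemma ngon_pair_hessian t m p q p' q' : (0 < m < n)%N ->
  let c := cos (ang m) in let s := sin (ang m) in
  pair_hessian (unitvec t - unitvec (t + ang m))
               (frame t p q - frame (t + ang m) p' q') =
  (2 * dist m ^+ 3)^-1 *: frame t
    ((1 - 3 * c) * p - 3 * s * q + (3 - c) * p' + s * q')
    ((1 + 3 * c) * q - 3 * s * p - (3 + c) * q' - s * p').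
Proof.
move=> mn c s; rewrite !frame10 !frame_rotate !frameB.
have cs : c ^+ 2 + s ^+ 2 = 1 by exact: cos2Dsin2.
rewrite !mul1r !mul0r subr0 addr0 sub0r pair_hessian_frame //; last first.
  exact: cos_ang_neq1.
rewrite dist_frame //; congr (_ *: frame _ _ _).
  (* The expanded coordinate differs from the target by a multiple of [c ^+ 2 + s ^+ 2 - 1], made
     explicit so that [ring] applies. *)
  transitivity ((1 - 3 * c) * p - 3 * s * q + (3 - c) * p' + s * q' +
    3 * p' * (c ^+ 2 + s ^+ 2 - 1)); first by rewrite /c /s; ring.
  by rewrite cs subrr mulr0 addr0.
transitivity ((1 + 3 * c) * q - 3 * s * p - (3 + c) * q' - s * p' -
    3 * q' * (c ^+ 2 + s ^+ 2 - 1)); first by rewrite /c /s; ring.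
by rewrite cs subrr mulr0 subr0.
Qed.

Lemma hessian_mode l :
  hessian (@newtonU R n) (ngon R n) *m mode_mx l = mode_mx l *m mode_hessian l.
Proof.
apply: eq_mulmx_col => x; rewrite -!mulmxA !mode_mx_mul.
have per k : unitvec (ang (k + n)%N) = unitvec (ang k) :> 'rV[R]_2.
  have := (@cos_angDn R n n_gt0 k 1, @sin_angDn R n n_gt0 k 1).
  by rewrite muln1 => -[ck sk]; apply/rowP => c; rewrite !mxE ck sk.
rewrite hessian_newtonU_stack //; last exact: ngon_collision_free.
- apply: eq_stack => k _.
  rewrite /mode_coef; have [-> -> -> ->] := mode_hessianE l x.
  move: (x 0 0) (x 1 0) (x 2 0) (x 3 0) => A C B D {x}.
  set K := ang (k * l).
  pose wt m := (2 * dist m ^+ 3)^-1.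
  pose c m := cos (ang m); pose s m := sin (ang m).
  pose cl m := cos (ang (m * l)); pose sl m := sin (ang (m * l)).
  have rev m : (0 < m < n)%N ->
     [/\ wt (n - m)%N = wt m, c (n - m)%N = c m, s (n - m)%N = - s m,
         cl (n - m)%N = cl m & sl (n - m)%N = - sl m].
    move=> mn; have mn' : (m <= n)%N by lia.
    have := (@cos_ang_rev R n n_gt0 m 1 mn', @sin_ang_rev R n n_gt0 m 1 mn').
    rewrite !muln1 => -[e1 e2].
    by split=> //; rewrite /wt /cl /sl ?dist_rev // (cos_ang_rev, sin_ang_rev).
  (* By the addition formulas the coordinates at body [k + m] are [p * cl m + p1 * sl m] and
     [q * cl m + q1 * sl m]. *)
  set p := A * cos K + B * sin K; set q := C * cos K + D * sin K.
  set p1 := B * cos K - A * sin K; set q1 := D * cos K - C * sin K.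
  (* In each coordinate the leading products are even under [m -> n - m] and sum to the coefficients
     [a_], [b_], [S_]; the last group is odd and sums to zero. *)
  transitivity (\sum_(1 <= m < n) frame (ang k)
    (wt m * (1 - c m * cl m - 3 * (c m - cl m)) * p + wt m * (sl m * s m) * q1 +
     wt m * ((3 - c m) * sl m * p1 + s m * cl m * q - 3 * s m * q))
    (wt m * (1 - c m * cl m + 3 * (c m - cl m)) * q - wt m * (sl m * s m) * p1 +
     - (wt m * ((3 + c m) * sl m * q1 + s m * cl m * p + 3 * s m * p)))).
    apply: eq_big_nat => m mn.
    rewrite /ngon_vertex angD // ngon_pair_hessian // -/(wt m) frameZ.
    rewrite angDM // cosD sinD -/K -/(c m) -/(s m) -/(cl m) -/(sl m).
    by congr frame; rewrite /p /q /p1 /q1; ring.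
  rewrite frame_sum; congr frame; rewrite big_split /=.
    rewrite [X in _ + X]sum_odd ?addr0; last first.
      by move=> m /rev[-> -> -> -> ->]; ring.
    rewrite big_split -!mulr_suml /=.
    transitivity (a_ R n l * p + S_ R n l * q1).
      congr (_ * _ + _ * _).
        by rewrite /a_ /P_ /Q_ mulr_sumr -sumrB; apply: eq_big_nat => m _;
           rewrite -/(wt m) -/(c m) -/(cl m); ring.
      by apply: eq_big_nat => m _; rewrite mulrC.
    by rewrite /p /q1; ring.
  rewrite [X in _ + X]sum_odd ?addr0; last first.
    by move=> m /rev[-> -> -> -> ->]; ring.
  rewrite sumrB -!mulr_suml /=.
  transitivity (b_ R n l * q - S_ R n l * p1).
    congr (_ * _ - _ * _).
      by rewrite /b_ /P_ /Q_ mulr_sumr -big_split; apply: eq_big_nat => m _ /=;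
         rewrite -/(wt m) -/(c m) -/(cl m); ring.
    by apply: eq_big_nat => m _; rewrite mulrC.
  by rewrite /q /p1; ring.
- move=> k; rewrite /mode_coef mulnDl cos_angDn // sin_angDn //.
  by rewrite /frame per.
Qed.

End Modes.

(** * Orthogonality relations *)

Section Gram.
Variables (R : realType) (n : nat).
Hypothesis n_gt0 : (0 < n)%N.
Local Notation ang := (ang R n).
Local Notation mode_mx := (mode_mx R n).
Local Notation cos_sum := (cos_sum R n).

Lemma eq_bilinear_mx p q (X Y : 'M[R]_(p, q)) :
  (forall (x : 'cV[R]_p) (y : 'cV[R]_q),
     x^T *m (X *m y) = x^T *m (Y *m y)) -> X = Y.
Proof.
move=> XY; apply: eq_mulmx_col => y; apply/colP => i.
have /matrixP /(_ 0 0) := XY (delta_mx i 0) y.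
by rewrite trmx_delta -!rowE !mxE.
Qed.

Definition gram_diag (a b : R) : 'M[R]_4 :=
  diag_mx (\row_i if (i < 2)%N then a else b).

Lemma cos_sum0 : cos_sum 0 = n%:R.
Proof. by have := @cos_sum_full R n n_gt0 0; rewrite muln0. Qed.

(** Inner products do not see the frame angle, so only products of cosines and sines remain.
    Product-to-sum formulas turn them into sums at frequencies [l - l'] and [l + l'], whose sine
    parts vanish. *)
Lemma mode_gram l l' : (l' <= l)%N ->
  (mode_mx l)^T *m mode_mx l' =
  gram_diag ((cos_sum (l - l') + cos_sum (l + l')) / 2)
            ((cos_sum (l - l') - cos_sum (l + l')) / 2).
Proof.
move=> ll; apply: eq_bilinear_mx => x y; apply/matrixP => i j; rewrite !ord1.
rewrite -!mulmxA mulmxA -trmx_mul !mode_mx_mul dot_stack.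
rewrite mul_diag_mx [RHS]mxE sum4 !mxE /=.
under eq_bigr => k _.
  rewrite dot_frame.
  have E : ang (k.+1 * (l - l')) = ang (k.+1 * l) - ang (k.+1 * l').
    by rewrite -{2}(subnK ll) mulnDr angD // addrK.
  rewrite (_ : _ + _ =
    (x 0 0 * y 0 0 + x 1 0 * y 1 0 + x 2 0 * y 2 0 + x 3 0 * y 3 0) / 2 *
      cos (ang (k.+1 * (l - l'))) +
    (x 0 0 * y 0 0 + x 1 0 * y 1 0 - x 2 0 * y 2 0 - x 3 0 * y 3 0) / 2 *
      cos (ang (k.+1 * (l + l'))) +
    (x 2 0 * y 0 0 + x 3 0 * y 1 0 - x 0 0 * y 2 0 - x 1 0 * y 3 0) / 2 *
      sin (ang (k.+1 * (l - l'))) +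
    (x 2 0 * y 0 0 + x 3 0 * y 1 0 + x 0 0 * y 2 0 + x 1 0 * y 3 0) / 2 *
      sin (ang (k.+1 * (l + l')))); last first.
    by rewrite E cosB sinB mulnDr angD // cosD sinD; field.
  over.
rewrite !big_split -!mulr_sumr /= !sum_sin_ang // -!/(cos_sum _).
by field.
Qed.

Lemma mode_gram_neq l l' : l != l' -> (l <= n./2)%N -> (l' <= n./2)%N ->
  (mode_mx l)^T *m mode_mx l' = 0.
Proof.
have G m m' : (m' < m)%N -> (m <= n./2)%N -> (mode_mx m)^T *m mode_mx m' = 0.
  (* Both [m - m'] and [m + m'] lie strictly between 0 and [n]. *)
  move=> mm mn; rewrite mode_gram ?(ltnW mm) // !cos_sum_eq0; try lia.
  rewrite addr0 subr0 mul0r; apply/matrixP => i j.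
  by rewrite !mxE if_same mul0rn.
rewrite neq_ltn => /orP[ll|ll] ln ln'; last exact: G.
by rewrite -[LHS]trmxK trmx_mul trmxK G // trmx0.
Qed.

Lemma mode_gram_generic l : (0 < 2 * l < n)%N ->
  (mode_mx l)^T *m mode_mx l = (n%:R / 2)%:M.
Proof.
move=> ln; rewrite mode_gram // subnn addnn -mul2n (@cos_sum_eq0 _ _ _ (2 * l)) //.
rewrite cos_sum0 addr0 subr0.
by apply/matrixP => i j; rewrite !mxE if_same.
Qed.

(** Here both cosine sums equal [n]: the first two columns have squared length [n] rather than
    [n / 2], and the last two vanish. *)
Lemma mode_gram_special l : (2 * l == 0)%N || (2 * l == n)%N ->
  (mode_mx l)^T *m mode_mx l = gram_diag n%:R 0.
Proof.
move=> ln; rewrite mode_gram // subnn addnn -mul2n.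
have -> : cos_sum (2 * l) = n%:R.
  case/orP: ln => /eqP ->; first exact: cos_sum0.
  by rewrite -[X in cos_sum X](muln1 n) cos_sum_full.
rewrite cos_sum0 subrr mul0r.
by congr gram_diag; field.
Qed.

Lemma diagJ_mode l : diagJ R (2 * n) *m mode_mx l = mode_mx l *m diagJ R 4.
Proof.
apply: eq_mulmx_col => x; rewrite -!mulmxA !mode_mx_mul diagJ_stack.
apply: eq_stack => k _; rewrite /mode_coef rot90_frame.
by congr frame; rewrite ![(diagJ _ _ *m _) _ _]mxE !sum4 !diagJE /=; ring.
Qed.

(** * Coefficients at the frequencies 0, 1 and n/2 *)

Lemma P_0E : P_ R n 0 = lambda R n / 2.
Proof.
rewrite /P_ /lambda !mulr_sumr mulr_suml; apply: eq_big_nat => m mn.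
rewrite muln0 {1}/Defs.ang mulr0 mul0r cos0 mul1r.
have -> : 1 - cos (ang m) = dist R n m ^+ 2 / 2.
  by rewrite dist_sqr //; field.
rewrite distE //; have := sin_half_ang_gt0 R n_gt0 mn; move: (sin _) => s s0.
by field; rewrite gt_eqF.
Qed.

(** Together with [P_0E] this gives [a_ 0 = 2 * lambda] and [b_ 0 = - lambda], the entries of
    [lambda *: U_0]. *)
Lemma Q_0E : Q_ R n 0 = - P_ R n 0.
Proof.
rewrite -sumrN; apply: eq_big_nat => m _.
by rewrite muln0 {2 3}/Defs.ang mulr0 mul0r cos0; ring.
Qed.

Lemma S_0E : S_ R n 0 = 0.
Proof.
apply: big1 => m _; rewrite muln0 {1}/Defs.ang mulr0 mul0r sin0; ring.
Qed.

Lemma Q_1E : Q_ R n 1 = 0.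
Proof. by apply: big1 => m _; rewrite muln1 subrr mul0r. Qed.

(** With [Q_1E] all nonzero entries of [mode_hessian 1] become [S_ 1] up to sign; its eigenvalues
    are then 0 (translations) and [2 * S_ 1], which is [z_]. *)
Lemma P_1E : P_ R n 1 = S_ R n 1.
Proof.
apply: eq_big_nat => m _; rewrite muln1; congr (_ / _).
by have := cos2Dsin2 (ang m); nra.
Qed.

Lemma z_E : z_ R n = 2 * S_ R n 1.
Proof.
rewrite mulr_sumr; apply: eq_big_nat => m _; rewrite muln1 mulrA; congr (_ / _).
by rewrite mulr_natl cos_mulr2n; have := cos2Dsin2 (ang m); nra.
Qed.

Lemma S_half l : (2 * l = n)%N -> S_ R n l = 0.
Proof.
move=> ln; apply: big1 => m _.
have angl : ang l = pi.
  have l0 : l%:R != 0 :> R by rewrite pnatr_eq0; lia.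
  by rewrite /Defs.ang -ln natrM; field.
have -> : sin (ang (m * l)) = 0; last by rewrite !mul0r.
elim: m => [|m IH]; first by rewrite mul0n /Defs.ang mulr0 mul0r sin0.
by rewrite mulSn angD // sinD angl sinpi IH; ring.
Qed.

Lemma lambda_gt0 : (1 < n)%N -> 0 < lambda R n.
Proof.
move=> n1; rewrite mulr_gt0 ?invr_gt0 ?ltr0n //.
have s0 m : (0 < m < n)%N -> 0 < (sin (pi * m%:R / n%:R : R))^-1.
  by move=> mn; rewrite invr_gt0 sin_half_ang_gt0.
rewrite big_ltn // ltr_pwDl ?s0 // big_seq sumr_ge0 // => m.
by rewrite mem_index_iota => mn; apply/ltW/s0; lia.
Qed.

End Gram.

(** * Assembling the blocks *)

Section Blocks.
Variables (R : realType) (n : nat).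
Hypothesis n_ge3 : (3 <= n)%N.
Local Notation ang := (ang R n).
Local Notation mode_mx := (mode_mx R n).
Local Notation lambda := (lambda R n).
Local Notation H := (hessian (@newtonU R n) (ngon R n)).

Let n_gt0 : (0 < n)%N. Proof. by lia. Qed.
Let n_neq0 : n%:R != 0 :> R. Proof. by rewrite pnatr_eq0 -lt0n. Qed.
Let lambda_neq0 : lambda != 0.
Proof. by rewrite gt_eqF // lambda_gt0 //; lia. Qed.

(** [K] holds the coordinates of [X] in the frequency-[l] span, which reduces the Hessian and
    rotation conditions to identities between matrices with four rows. *)
Definition mode_block l d (X : 'M[R]_(2 * n, d)) (U : 'M[R]_d) :=
  exists K : 'M[R]_(4, d),
  [/\ X = mode_mx l *m K, X^T *m X = 1%:M,
      mode_hessian R n l *m K = K *m (lambda *: U) &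
      diagJ R 4 *m K = K *m diagJ R d].

(** The form that survives juxtaposition of blocks of different frequencies; evenness of [d] keeps
    [diagJ] block diagonal there. *)
Definition diagonalizes d (X : 'M[R]_(2 * n, d)) (U : 'M[R]_d) :=
  [/\ X^T *m X = 1%:M, H *m X = X *m (lambda *: U),
      diagJ R (2 * n) *m X = X *m diagJ R d & ~~ odd d].

Lemma mode_block_diagonalizes l d (X : 'M[R]_(2 * n, d)) U : ~~ odd d ->
  mode_block l X U -> diagonalizes X U.
Proof.
move=> d_even [K [-> XX WK JK]]; split=> //.
  by rewrite mulmxA hessian_mode // -!mulmxA WK.
by rewrite mulmxA diagJ_mode -!mulmxA JK.
Qed.

Lemma mode_block_orthogonal l l' d d'
    (X : 'M[R]_(2 * n, d)) U (Y : 'M[R]_(2 * n, d')) V :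
  l != l' -> (l <= n./2)%N -> (l' <= n./2)%N ->
  mode_block l X U -> mode_block l' Y V -> X^T *m Y = 0.
Proof.
move=> ll ln ln' [K [-> _ _ _]] [K' [-> _ _ _]].
by rewrite trmx_mul -mulmxA (mulmxA _ (mode_mx l')) mode_gram_neq // mul0mx mulmx0.
Qed.

(** Selects [v l] and [J v l], for the frequencies 0 and n/2 at which [w l] vanishes. *)
Definition half_basis : 'M[R]_(4, 2) :=
  mxrows 4 2 [:: [:: 1; 0]; [:: 0; 1]; [:: 0; 0]; [:: 0; 0]].

(* In complex notation [1 = e^(- i theta) u] and [e^(2 i theta) = e^(i theta) u]
   with [u = e^(i theta)], so both [e1] and [v(1)] lie in the span of
   frequency 1. *)
Definition constant_basis : 'M[R]_(4, 2) :=
  mxrows 4 2 [:: [:: 1; 0]; [:: 0; 1]; [:: 0; 1]; [:: -1; 0]].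
Definition double_basis : 'M[R]_(4, 2) :=
  mxrows 4 2 [:: [:: 1; 0]; [:: 0; 1]; [:: 0; -1]; [:: 1; 0]].

Lemma sum2 (V : nmodType) (F : 'I_2 -> V) : \sum_i F i = F 0 + F 1.
Proof.
by rewrite big_ord_recl big_ord1; congr (_ + F _); apply/val_inj.
Qed.

Lemma mulmx_mode_col l (K : 'M[R]_(4, 2)) x :
  stack n x = stack n (mode_coef n l (col 0 K)) ->
  stack n (fun k => rot90 (x k)) = stack n (mode_coef n l (col 1 K)) ->
  mxcols 2 [:: stack n x; diagJ R (2 * n) *m stack n x] = mode_mx l *m K.
Proof.
rewrite -diagJ_stack -!mode_mx_mul => x0 x1; apply/matrixP => i j.
transitivity ((mode_mx l *m col j K) i 0); last first.
  by rewrite colE mulmxA -colE [LHS]mxE.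
rewrite mxE; case: j => -[|[|//]] h /=.
- by rewrite x0; congr ((_ *m col _ _) _ _); apply/val_inj.
- by rewrite x1; congr ((_ *m col _ _) _ _); apply/val_inj.
Qed.

Lemma ord2P (i : 'I_2) : i = 0 \/ i = 1.
Proof. by case: i => -[|[|//]] h; [left|right]; apply/val_inj. Qed.

Lemma ord4P (i : 'I_4) : [\/ i = 0, i = 1, i = 2 | i = 3].
Proof.
by case: i => -[|[|[|[|//]]]] h;
  [constructor 1|constructor 2|constructor 3|constructor 4]; apply/val_inj.
Qed.

Lemma matrix2P (X Y : 'M[R]_2) :
  X 0 0 = Y 0 0 -> X 0 1 = Y 0 1 -> X 1 0 = Y 1 0 -> X 1 1 = Y 1 1 -> X = Y.
Proof.
move=> e0 e1 e2 e3; apply/matrixP => i j.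
by case: (ord2P i) (ord2P j) => -> [] ->.
Qed.

Lemma matrix42P (X Y : 'M[R]_(4, 2)) :
  (forall i, X i 0 = Y i 0) -> (forall i, X i 1 = Y i 1) -> X = Y.
Proof. by move=> e0 e1; apply/matrixP => i j; case: (ord2P j) => ->. Qed.

(** The conditions say that each 2 x 2 half of [K] is multiplication by a complex number, hence
    commutes with the quarter turn. *)
Lemma diagJ4_mul (K : 'M[R]_(4, 2)) :
  K 0 1 = - K 1 0 -> K 1 1 = K 0 0 -> K 2 1 = - K 3 0 -> K 3 1 = K 2 0 ->
  diagJ R 4 *m K = K *m diagJ R 2.
Proof.
move=> e0 e1 e2 e3; apply: matrix42P => i; rewrite !mxE sum4 sum2 !diagJE /=;
  by case: (ord4P i) => -> /=; rewrite ?e0 ?e1 ?e2 ?e3; ring.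
Qed.

Let sqrt_n : Num.sqrt n%:R ^+ 2 = n%:R :> R.
Proof. by rewrite sqr_sqrtr // ler0n. Qed.

Let sqrt_n_neq0 : Num.sqrt n%:R != 0 :> R.
Proof. by rewrite sqrtr_eq0 -ltNge ltr0n. Qed.

Lemma trmx_scale p q (a : R) (X : 'M[R]_(p, q)) : (a *: X)^T = a *: X^T.
Proof. by apply/matrixP => i j; rewrite !mxE. Qed.

Lemma gram_columns l (K : 'M[R]_(4, 2)) (g : 'M[R]_4) :
  (mode_mx l)^T *m mode_mx l = g -> K^T *m (g *m K) = n%:R%:M ->
  let X := (Num.sqrt n%:R)^-1 *: (mode_mx l *m K) in X^T *m X = 1%:M.
Proof.
move=> <- gK X; rewrite /X trmx_scale -scalemxAl -scalemxAr scalerA trmx_mul.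
rewrite -mulmxA (mulmxA _ (mode_mx l)) gK scale_scalar_mx.
by congr _%:M; rewrite -[in X in _ * X]sqrt_n; field.
Qed.

Let ang0 : ang 0 = 0.
Proof. by rewrite /Defs.ang mulr0 mul0r. Qed.

Lemma A_cenE : A_cen R n = (Num.sqrt n%:R)^-1 *: (mode_mx 1 *m constant_basis).
Proof.
congr (_ *: _); apply: mulmx_mode_col; apply: eq_stack => k _.
  apply/rowP => -[[|[|//]] h]; rewrite !mxE /= muln1;
  by have := cos2Dsin2 (ang k); nra.
by apply/rowP => -[[|[|//]] h]; rewrite !mxE /= muln1;
  have := cos2Dsin2 (ang k); nra.
Qed.

Lemma A_cen_block : mode_block 1 (A_cen R n) 0.
Proof.
have E := A_cenE.
exists ((Num.sqrt n%:R)^-1 *: constant_basis); split.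
- by rewrite E scalemxAr.
- rewrite E; apply: gram_columns; first by apply: mode_gram_generic => //; lia.
  (* The columns of [constant_basis] have squared length 2, which compensates the factor [n / 2] of
     the generic Gram matrix. *)
  by apply: matrix2P; rewrite mul_scalar_mx !mxE sum4 !mxE /=; field.
- rewrite -scalemxAr scaler0 mulmx0.
  suff -> : mode_hessian R n 1 *m constant_basis = 0 by rewrite scaler0.
  apply: matrix42P => i; case: (ord4P i) => ->; rewrite mxE sum4 !mxE /=;
    by rewrite /a_ /b_ Q_1E P_1E; ring.
- by rewrite -scalemxAr -scalemxAl; congr (_ *: _); apply: diagJ4_mul;
    rewrite !mxE /= ?opprK ?oppr0.
Qed.

Lemma A_0_block : mode_block 0 (A_0 R n) (U_0 R).
Proof.
have E : A_0 R n = (Num.sqrt n%:R)^-1 *: (mode_mx 0 *m half_basis).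
  congr (_ *: _); apply: mulmx_mode_col; apply: eq_stack => k _;
  apply/rowP => -[[|[|//]] h]; rewrite !mxE /= muln0 ang0 cos0 sin0; ring.
exists ((Num.sqrt n%:R)^-1 *: half_basis); split.
- by rewrite E scalemxAr.
- rewrite E; apply: gram_columns; first by apply: mode_gram_special.
  by apply: matrix2P; rewrite mul_diag_mx !mxE sum4 !mxE /=; ring.
- rewrite -scalemxAr -scalemxAl; congr (_ *: _).
  apply: matrix42P => i; case: (ord4P i) => ->; rewrite !mxE sum4 sum2 !mxE /=
     /a_ /b_ Q_0E S_0E P_0E //; by field.
- by rewrite -scalemxAr -scalemxAl; congr (_ *: _); apply: diagJ4_mul;
    rewrite !mxE /= ?opprK ?oppr0.
Qed.

Lemma A_1E : A_1 R n = (Num.sqrt n%:R)^-1 *: (mode_mx 1 *m double_basis).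
Proof.
congr (_ *: _); apply: mulmx_mode_col; apply: eq_stack => k _;
apply/rowP => -[[|[|//]] h]; rewrite !mxE /= muln1 mulr_natl ?cos_mulr2n ?sin_mulr2n;
  by have := cos2Dsin2 (ang k); nra.
Qed.

Lemma A_1_block : mode_block 1 (A_1 R n) (U_1 R n).
Proof.
have E := A_1E.
exists ((Num.sqrt n%:R)^-1 *: double_basis); split.
- by rewrite E scalemxAr.
- rewrite E; apply: gram_columns; first by apply: mode_gram_generic => //; lia.
  by apply: matrix2P; rewrite mul_scalar_mx !mxE sum4 !mxE /=; field.
- rewrite -scalemxAr -scalemxAl scalerA mulfV // scale1r; congr (_ *: _).
  apply: matrix42P => i; case: (ord4P i) => ->; rewrite !mxE sum4 sum2 !mxE /=
     /a_ /b_ Q_1E P_1E z_E; ring.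
- by rewrite -scalemxAr -scalemxAl; congr (_ *: _); apply: diagJ4_mul;
    rewrite !mxE /= ?opprK ?oppr0.
Qed.

Lemma A_half_block l : (2 * l = n)%N -> mode_block l (A_half R n l) (U_half R n l).
Proof.
move=> ln.
have E : A_half R n l = (Num.sqrt n%:R)^-1 *: (mode_mx l *m half_basis).
  congr (_ *: _); apply: mulmx_mode_col; apply: eq_stack => k _;
  by apply/rowP => -[[|[|//]] h]; rewrite !mxE /=; ring.
exists ((Num.sqrt n%:R)^-1 *: half_basis); split.
- by rewrite E scalemxAr.
- rewrite E; apply: gram_columns.
    by apply: mode_gram_special; rewrite // ln eqxx orbT.
  by apply: matrix2P; rewrite mul_diag_mx !mxE sum4 !mxE /=; ring.
- rewrite -scalemxAr -scalemxAl scalerA mulfV // scale1r; congr (_ *: _).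
  apply: matrix42P => i; case: (ord4P i) => ->;
    by rewrite !mxE sum4 sum2 !mxE /= S_half //; ring.
- by rewrite -scalemxAr -scalemxAl; congr (_ *: _); apply: diagJ4_mul;
    rewrite !mxE /= ?opprK ?oppr0.
Qed.

Lemma A_gen_block l : (0 < 2 * l < n)%N -> mode_block l (A_gen R n l) (U_gen R n l).
Proof.
(* The block is the whole span, so its coordinate matrix is the normalizing scalar. *)
move=> ln; exists (Num.sqrt (2 / n%:R))%:M; split.
- by rewrite mul_mx_scalar.
- rewrite trmx_scale -scalemxAl -scalemxAr scalerA mode_gram_generic //.
  rewrite scale_scalar_mx -expr2 sqr_sqrtr ?divr_ge0 ?ler0n //.
  by congr _%:M; field.
- by rewrite scalerA mulfV // scale1r mul_mx_scalar mul_scalar_mx.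
- by rewrite mul_mx_scalar mul_scalar_mx.
Qed.

Lemma A_block l : (0 < l <= n./2)%N -> mode_block l (A_ R n l) (U_ R n l).
Proof.
move=> ln; rewrite /A_ /U_ /mode_dim.
case: (boolP (generic_mode n l)) => [|ng].
  by rewrite /generic_mode => g; apply: A_gen_block; lia.
case: eqP => [->|l1]; first exact: A_1_block.
(* A frequency in range that is neither generic nor 1 satisfies [2 * l = n]. *)
by apply: A_half_block; rewrite /generic_mode in ng; lia.
Qed.

(** These two blocks share the frequency 1. As the Gram matrix is scalar there, orthogonality comes
    from that of the columns of [constant_basis] and [double_basis]. *)
Lemma A_cen_A_1 : (A_cen R n)^T *m A_1 R n = 0.
Proof.
have G : (mode_mx 1)^T *m mode_mx 1 = (n%:R / 2)%:M.
  by apply: mode_gram_generic; lia.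
rewrite A_cenE A_1E trmx_scale -scalemxAl -scalemxAr trmx_mul.
rewrite -mulmxA (mulmxA _ (mode_mx 1)) G.
rewrite mul_scalar_mx -!scalemxAr (_ : _ *m _ = 0) ?scaler0 //.
by apply: matrix2P; rewrite !mxE sum4 !mxE /=; ring.
Qed.

(** * Juxtaposed blocks and symplectic sums *)

Lemma diagJ_block p q : ~~ odd p ->
  diagJ R (p + q) = block_mx (diagJ R p) 0 0 (diagJ R q).
Proof.
move=> pe; apply/matrixP => i j.
case: (splitP i) => i' ei; case: (splitP j) => j' ej.
- have -> : i = lshift q i' by apply/val_inj.
  by have -> : j = lshift q j' by [apply/val_inj]; rewrite block_mxEul !diagJE.
- have -> : i = lshift q i' by apply/val_inj.
  have -> : j = rshift p j' by apply/val_inj.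
  rewrite block_mxEur !diagJE mxE /=; case: eqP => // e.
  by have := ltn_ord i'; lia.
- have -> : i = rshift p i' by apply/val_inj.
  have -> : j = lshift q j' by apply/val_inj.
  rewrite block_mxEdl !diagJE mxE /=; case: eqP => // e.
  by have := ltn_ord j'; lia.
- have -> : i = rshift p i' by apply/val_inj.
  have -> : j = rshift p j' by apply/val_inj.
  rewrite block_mxEdr !diagJE /= !oddD (negPf pe) /=.
  by congr (if _ then _ else _); apply/eqP/eqP; lia.
Qed.

Lemma diagonalizes_row p q (X : 'M[R]_(2 * n, p)) U (Y : 'M[R]_(2 * n, q)) V :
  diagonalizes X U -> diagonalizes Y V -> X^T *m Y = 0 ->
  diagonalizes (row_mx X Y) (block_mx U 0 0 V).
Proof.
move=> [XX HX JX pe] [YY HY JY qe] XY; split; last by rewrite oddD (negPf pe).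
- rewrite tr_row_mx mul_col_row XX YY XY.
  have -> : Y^T *m X = 0 by rewrite -[LHS]trmxK trmx_mul trmxK XY trmx0.
  by rewrite -scalar_mx_block.
- rewrite mul_mx_row HX HY scale_block_mx !scaler0 mul_row_block.
  by rewrite !mulmx0 addr0 add0r.
- by rewrite mul_mx_row JX JY diagJ_block // mul_row_block !mulmx0 addr0 add0r.
Qed.

(** Follows the recursion of [bigrow] and [bigsympsum], so that the three unfold together in
    inductions. *)
Fixpoint bigdiag (d : nat -> nat) (U : forall l, 'M[R]_(d l)) k :
    'M[R]_(sumdim d k) :=
  match k with
  | 0 => 0
  | k'.+1 => block_mx (bigdiag U k') 0 0 (U k'.+1)
  end.

Lemma orthogonal_bigrow m p (X : 'M[R]_(m, p)) d (C : forall l, 'M[R]_(m, d l)) k :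
  (forall l, (0 < l <= k)%N -> X^T *m C l = 0) -> X^T *m bigrow C k = 0.
Proof.
elim: k => [|k IH] XC /=; first by rewrite mulmx0.
rewrite mul_mx_row XC ?leqnn // IH ?row_mx0 // => l lk; apply: XC; lia.
Qed.

Lemma diagonalizes_bigrow d (C : forall l, 'M[R]_(2 * n, d l)) U k :
  (forall l, (0 < l <= k)%N -> diagonalizes (C l) (U l)) ->
  (forall l l', (0 < l <= k)%N -> (0 < l' <= k)%N -> l != l' ->
     (C l)^T *m C l' = 0) ->
  diagonalizes (bigrow C k) (bigdiag U k).
Proof.
elim: k => [|k IH] CU CC /=.
  by split=> //; rewrite ?mulmx0 ?scaler0 ?mulmx0 ?mul0mx //; apply/matrixP => -[].
apply: diagonalizes_row.
- by apply: IH => [l lk|l l' lk lk' ll]; [apply: CU|apply: CC]; lia.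
- by apply: CU; lia.
- rewrite -[LHS]trmxK trmx_mul trmxK orthogonal_bigrow ?trmx0 // => l lk.
  by apply: CC; lia.
Qed.

(** All four quarters of the coefficient matrix are block diagonal, which is the pattern of a
    symplectic sum. Evenness of [p] is what splits [diagJ]. *)
Lemma kepler_coef_block p q (U : 'M[R]_p) (V : 'M[R]_q) ecc theta : ~~ odd p ->
  kepler_coef (block_mx U 0 0 V) ecc theta =
  kepler_coef U ecc theta <+> kepler_coef V ecc theta.
Proof.
move=> pe; rewrite /sympsum /kepler_coef.
rewrite !block_mxKul !block_mxKur !block_mxKdl !block_mxKdr.
rewrite diagJ_block // (scalar_mx_block p q) add_block_mx scale_block_mx.
by rewrite !opp_block_mx add_block_mx !(addr0, scaler0, oppr0).
Qed.

Lemma kepler_coef_bigdiag d (U : forall l, 'M[R]_(d l)) k ecc theta :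
  (forall l, ~~ odd (d l)) ->
  kepler_coef (bigdiag U k) ecc theta =
  bigsympsum (fun l => kepler_coef (U l) ecc theta) k.
Proof.
move=> de; elim: k => [|k IH] /=; first by apply/matrixP => -[].
rewrite kepler_coef_block ?IH //.
by elim: (k) => //= m IHm; rewrite oddD (negPf IHm) (negPf (de _)).
Qed.

Definition ngon_row : 'M[R]_(2 * n, 2 + 2 + sumdim (mode_dim n) n./2) :=
  row_mx (row_mx (A_cen R n) (A_0 R n)) (bigrow (@A_ R n) n./2).

Lemma mode_dim_even l : ~~ odd (mode_dim n l).
Proof. by rewrite /mode_dim; case: ifP. Qed.

Lemma ngon_row_diagonalizes :
  diagonalizes ngon_row
    (block_mx (block_mx 0 0 0 (U_0 R)) 0 0 (bigdiag (@U_ R n) n./2)).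
Proof.
have n2 : (0 < n./2)%N by lia.
have cen := A_cen_block; have zero := A_0_block.
apply: diagonalizes_row.
- apply: diagonalizes_row.
  + exact: mode_block_diagonalizes cen.
  + exact: mode_block_diagonalizes zero.
  + exact: mode_block_orthogonal cen zero.
- apply: diagonalizes_bigrow => [l ln|l l' ln ln' ll].
    by apply: mode_block_diagonalizes (A_block ln); exact: mode_dim_even.
  by apply: mode_block_orthogonal (A_block ln) (A_block ln'); lia.
- apply: orthogonal_bigrow => l ln.
  rewrite tr_row_mx mul_col_mx; apply/eqP; rewrite -col_mx0; apply/eqP.
  congr col_mx; last by apply: mode_block_orthogonal zero (A_block ln); lia.
  (* At [l = 1] the frequency is that of [A_cen], so orthogonality of distinct frequencies does not
     apply. *)
  have [->|l1] := eqVneq l 1%N; first exact: A_cen_A_1.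
  by apply: mode_block_orthogonal cen (A_block ln); lia.
Qed.

(** * Transport along equalities of dimensions *)

Lemma castmx_conj m d d' (e : d = d') (X : 'M[R]_(m, d)) (S : 'M[R]_m) :
  (castmx (erefl, e) X)^T *m S *m castmx (erefl, e) X =
  castmx (e, e) (X^T *m S *m X).
Proof. by case: _ / e; rewrite !castmx_id. Qed.

Lemma kepler_coef_cast d d' (e : d = d') (V : 'M[R]_d) ecc theta :
  kepler_coef (castmx (e, e) V) ecc theta =
  castmx (congr2 addn e e, congr2 addn e e) (kepler_coef V ecc theta).
Proof. by case: _ / e; rewrite !castmx_id. Qed.

Lemma castmx1 d d' (e : d = d') : castmx (e, e) 1%:M = 1%:M :> 'M[R]_d'.
Proof. by case: _ / e; rewrite castmx_id. Qed.

Lemma castmx_scale d d' (e : d = d') a (X : 'M[R]_d) :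
  a *: castmx (e, e) X = castmx (e, e) (a *: X).
Proof. by case: _ / e; rewrite !castmx_id. Qed.

Lemma mul_castmx_diagJ m d d' (e : d = d') (X : 'M[R]_(m, d)) :
  castmx (erefl, e) X *m diagJ R d' = castmx (erefl, e) (X *m diagJ R d).
Proof. by case: _ / e; rewrite !castmx_id. Qed.

Lemma mulmx_castmx m d d' (e : d = d') (S : 'M[R]_m) (X : 'M[R]_(m, d)) :
  S *m castmx (erefl, e) X = castmx (erefl, e) (S *m X).
Proof. by case: _ / e; rewrite !castmx_id. Qed.

Lemma ngon_A_commutes :
  diagJ R (2 * n) *m ngon_A R n_ge3 = ngon_A R n_ge3 *m diagJ R (2 * n).
Proof.
have [_ _ JA _] := ngon_row_diagonalizes.
by rewrite /ngon_A -/ngon_row mulmx_castmx JA mul_castmx_diagJ.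
Qed.

Lemma ngon_A_orthogonal : (ngon_A R n_ge3)^T *m ngon_A R n_ge3 = 1%:M.
Proof.
have [AA _ _ _] := ngon_row_diagonalizes.
rewrite /ngon_A -/ngon_row -[X in X *m _]mulmx1 castmx_conj.
by rewrite mulmx1 AA castmx1.
Qed.

Lemma ngon_B_split (ecc theta : R) :
  ngon_B n_ge3 ecc theta = castmx (ngon_dim2 n_ge3, ngon_dim2 n_ge3)
    (B_1 ecc theta <+> B_2 ecc theta <+> B_3 n ecc theta).
Proof.
have [AA HA _ _] := ngon_row_diagonalizes.
(* Invariance and orthonormality turn the conjugated Hessian into [lambda] times the block-diagonal
   matrix; the factor [lambda^-1] then cancels. *)
rewrite /ngon_B /ngon_A -/ngon_row castmx_conj -mulmxA HA mulmxA AA mul1mx.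
rewrite castmx_scale scalerA mulVf // scale1r kepler_coef_cast.
by rewrite !kepler_coef_block // kepler_coef_bigdiag //; exact: mode_dim_even.
Qed.

End Blocks.

Theorem theorem1p3 (R : realType) (n : nat) (hn : (3 <= n)%N) (ecc : R)
    (hecc : 0 <= ecc < 1) :
  let A := ngon_A R hn in
  let B := ngon_B hn ecc in
  let B' := fun theta => castmx (ngon_dim2 hn, ngon_dim2 hn)
    (B_1 ecc theta <+> B_2 ecc theta <+> B_3 n ecc theta) in
  [/\ diagJ R (2 * n) *m A = A *m diagJ R (2 * n),
      A^T *m A = 1%:M,
      forall theta : R, 0 <= theta <= 2 * pi -> B theta = B' theta &
      forall zeta : R -> 'M[R]_(2 * n + 2 * n),
        fundamental_solution B zeta <-> fundamental_solution B' zeta].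
Proof.
move=> A B B'.
(* Equality of the coefficient functions makes the two linear systems identical, solutions
   included. *)
have BB' : B = B' by apply/funext => theta; exact: ngon_B_split.
split=> [||theta _|zeta].
- exact: ngon_A_commutes.
- exact: ngon_A_orthogonal.
- by rewrite BB'.
- by rewrite BB'.
Qed.
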